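(* Let $S$ and $T$ be right modular groupoids with left identity elements $l$ and $k$ respectively. Then $S\cong T$ (as groupoids) if and only if $[S]\cong[T]$.
   Context: A groupoid is a set with a binary operation, written as juxtaposition. A groupoid is right modular if $(xy)z=(zy)x$ for all $x,y,z$. A left identity is an element $l$ with $lx=x$ for all $x$. For a groupoid $S$, $[S]$ denotes the set $S$ with its natural ternary operation $[abc]=(ab)c$. $[S]\cong[T]$ means that there is a bijection $\delta:S\to T$ with $\delta[abc]=[(\delta a)(\delta b)(\delta c)]$ for all $a,b,c\in S$. *)

(* Defs.v *)
From mathcomp Require Import ssreflect ssrfun ssrbool.

Set Implicit Arguments.
Unset Strict Implicit.
Unset Printing Implicit Defensive.

(* The carriers are arbitrary types: MathComp's magmaType would add a choice
   structure, hence decidable equality, that the mathematics does not require. *)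
Record groupoid := Groupoid {
  gcarrier :> Type;
  gmul : gcarrier -> gcarrier -> gcarrier
}.

Record ternary := Ternary {
  tcarrier :> Type;
  tmul : tcarrier -> tcarrier -> tcarrier -> tcarrier
}.

Definition right_modular (S : groupoid) : Prop :=
  forall x y z : S, gmul (gmul x y) z = gmul (gmul z y) x.

Definition left_identity (S : groupoid) (l : S) : Prop :=
  left_id l (@gmul S).

Definition groupoid_iso (S T : groupoid) : Prop :=
  exists2 f : S -> T, bijective f &
    forall x y : S, f (gmul x y) = gmul (f x) (f y).

(* The ternary structure [S], with [abc] = (ab)c. *)
Definition ternary_of (S : groupoid) : ternary :=
  @Ternary S (fun a b c => gmul (gmul a b) c).

Definition ternary_iso (A B : ternary) : Prop :=
  exists2 d : A -> B, bijective d &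
    forall a b c : A, d (tmul a b c) = tmul (d a) (d b) (d c).

(* Main.v *)
(* If d is an isomorphism of the ternary structures and e = d l, then
   [l l c] = c makes e e a left identity of T, hence e e = k, and [l a b] = ab
   gives d (ab) = (e (d a)) (d b).  Since p (q r) = q (p r) in T, the map
   a |-> e (d a) is multiplicative; it is bijective because left translation by
   e is the composite of the involutions x |-> x e and x |-> x k. *)
Require Import Defs.
From mathcomp Require Import ssreflect ssrfun ssrbool.

Lemma right_modular_medial {S : groupoid} (hS : right_modular S) (a b c d : S) :
  gmul (gmul a b) (gmul c d) = gmul (gmul a c) (gmul b d).
Proof. by rewrite hS (hS c d b) -hS. Qed.

(** The chain is [l = k l = (k k) l = (l k) k = k k = k]. *)
Lemma left_identity_unique {S : groupoid} (hS : right_modular S) {l k : S} :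
  left_identity l -> left_identity k -> l = k.
Proof. by move=> hl hk; rewrite -[LHS]hk -[in LHS](hk k) hS hl hk. Qed.

(** Writing [a] as [l a], the medial law turns [(l a) (b c)] into [(l b) (a c)]. *)
Lemma right_modular_mulCA {S : groupoid} (hS : right_modular S) {l : S}
    (hl : left_identity l) (a b c : S) :
  gmul a (gmul b c) = gmul b (gmul a c).
Proof. by rewrite -[X in gmul X _ = _]hl right_modular_medial // hl. Qed.

Lemma right_translation_involutive {S : groupoid} (hS : right_modular S)
    {l e : S} (hl : left_identity l) (ee : gmul e e = l) :
  involutive (fun x : S => gmul x e).
Proof. by move=> x; rewrite hS ee hl. Qed.

Lemma left_translation_bij {S : groupoid} (hS : right_modular S)
    {l e : S} (hl : left_identity l) (ee : gmul e e = l) :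
  bijective (gmul e).
Proof.
have Re := inv_bij (right_translation_involutive hS hl ee).
have Rl := inv_bij (right_translation_involutive hS hl (hl l)).
(* Right modularity gives [(x e) l = (l e) x = e x]. *)
apply: eq_bij (bij_comp Rl Re) _ _ => x /=.
by rewrite hS hl.
Qed.

Theorem theorem22 (S T : groupoid) (l : S) (k : T)
    (hS : right_modular S) (hT : right_modular T)
    (hl : left_identity l) (hk : left_identity k) :
  groupoid_iso S T <-> ternary_iso (ternary_of S) (ternary_of T).
Proof.
split=> [[f bij_f fM]|[d bij_d dM]].
  by exists f => // a b c /=; rewrite !fM.
rewrite /= in d bij_d dM.
have ee : gmul (d l) (d l) = k.
  apply: (left_identity_unique hT) hk => y.
  (* Surjectivity of [d] matters here: [dM] evaluates the product only once [y] is written as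
     [d (d' y)]. *)
  have [d' _ dK] := bij_d.
  by rewrite -(dK y) -dM !hl.
exists (gmul (d l) \o d).
  exact: bij_comp (left_translation_bij hT hk ee) bij_d.
move=> a b /=.
by rewrite -[in LHS](hl a) dM (right_modular_mulCA hT hk).
Qed.
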